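(* Let $k$ be a field with $\mathrm{char}\,k\neq2$, and let $\alpha,\beta\in k$ be such that $x^2-\alpha$ and $x^2-\beta$ are irreducible over $k$. For $q\in k$ let $$C_q:=k\langle x,y\mid x^2=\alpha,\ y^2=\beta,\ xy+yx=q\rangle .$$ Let $q,h\in k$ be such that $4\alpha\beta-q^2\neq0$ and $4\alpha\beta-h^2\neq0$. (1) The algebras $C_q$ and $C_h$ are isomorphic if, and only if, there exist $x,y\in k$ such that $$x^2-\alpha y^2=\frac{q^2-4\alpha\beta}{h^2-4\alpha\beta}.$$ (2) $C_q$ is isomorphic to the matrix ring $\mathcal{M}_2(k)$ if, and only if, there exist $x,y\in k$ such that $$x^2-\alpha y^2=q^2-4\alpha\beta.$$
   Context: Algebras are unital associative $k$-algebras and isomorphisms are isomorphisms of $k$-algebras. $k\langle x,y\mid\cdots\rangle$ denotes the quotient of the free algebra on $x,y$ by the indicated relations. *)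

(* Defs.v *)
From HB Require Import structures.
From mathcomp Require Import all_boot all_algebra.
From mathcomp Require Import ring boolp.
From mathcomp Require Import finmap monalg.

Set Implicit Arguments.
Unset Strict Implicit.
Unset Printing Implicit Defensive.

Import GRing.Theory.
Local Open Scope ring_scope.
Local Open Scope quotient_scope.

Definition algebra_isomorphic (k : comNzRingType) (A B : algType k) : Prop :=
  exists f : {lrmorphism A -> B}, bijective f.

(* The monoid algebra of the monoid of words on I.  It is an alias because
   malg only has a canonical algType instance over commutative monoids. *)
Definition free_alg (k : comNzRingType) (I : choiceType) : Type :=
  {malg k[{fmonom I}]}.

HB.instance Definition _ (k : comNzRingType) (I : choiceType) :=
  GRing.Lalgebra.on (free_alg k I).

Section FreeAlgebra.
Variables (k : comNzRingType) (I : choiceType).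

Fact free_scalerAr (c : k) (u v : free_alg k I) :
  c *: (u * v) = u * (c *: v).
Proof.
apply/malgP => m; rewrite mcoeffZ.
have sZ : (msupp (c *: v) `<=` msupp v)%fset by exact: msuppZ_le.
rewrite mcoeffMl (mcoeffMlw _ (fsubset_refl _) sZ) mulr_sumr.
apply: eq_bigr => m1 _; rewrite mulr_sumr; apply: eq_bigr => m2 _.
by rewrite mcoeffZ -mulrnAr mulrnAr mulrCA mulrnAr.
Qed.

HB.instance Definition _ :=
  GRing.Lalgebra_isAlgebra.Build k (free_alg k I) free_scalerAr.

(* The bundled algType, so that every structure on its elements is inferred
   through it rather than through malg. *)
Definition free_algebra : algType k := free_alg k I.

Definition free_gen (i : I) : free_algebra :=
  (<< 1 *g fmu i >> : free_alg k I).

End FreeAlgebra.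

Definition two_sided_ideal (A : nzRingType) (J : A -> Prop) : Prop :=
  [/\ J 0, forall u v, J u -> J v -> J (u + v)
    & forall a b u, J u -> J (a * u * b)].

(* Ideals are Prop-valued; MathComp quotients need a boolean predicate, hence
   the classical reflection. *)
Definition ideal_gen (A : nzRingType) (rs : seq A) : {pred A} :=
  fun u => `[< forall J : A -> Prop, two_sided_ideal J ->
                 (forall r, r \in rs -> J r) -> J u >].

Section IdealGen.
Variables (A : nzRingType) (rs : seq A).

Lemma ideal_genP u :
  reflect (forall J : A -> Prop, two_sided_ideal J ->
             (forall r, r \in rs -> J r) -> J u) (u \in ideal_gen rs).
Proof. exact: asboolP. Qed.

Lemma ideal_genM a b u : u \in ideal_gen rs -> a * u * b \in ideal_gen rs.
Proof.
move=> /ideal_genP uI; apply/ideal_genP => J JI Jrs.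
by case: (JI) => _ _; apply; exact: uI.
Qed.

Lemma ideal_genMl a u : u \in ideal_gen rs -> a * u \in ideal_gen rs.
Proof. by move=> uI; rewrite -[a * u]mulr1 ideal_genM. Qed.

Lemma ideal_genMr b u : u \in ideal_gen rs -> u * b \in ideal_gen rs.
Proof. by move=> uI; rewrite -[u]mul1r ideal_genM. Qed.

Fact ideal_gen_zmod_closed : zmod_closed (ideal_gen rs).
Proof.
split=> [|u v uI vI]; first by apply/ideal_genP => J [].
have nvI : - v \in ideal_gen rs by rewrite -mulN1r ideal_genMl.
apply/ideal_genP => J JI Jrs; case: (JI) => _ + _.
by apply; [exact: (ideal_genP _ uI)|exact: (ideal_genP _ nvI)].
Qed.

HB.instance Definition _ :=
  GRing.isZmodClosed.Build A (ideal_gen rs) ideal_gen_zmod_closed.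

End IdealGen.

(* Rings of type algType are nontrivial, hence the properness argument. *)
Definition alg_quot (k : comNzRingType) (A : algType k) (rs : seq A)
    (rsP : 1 \notin ideal_gen rs) : Type :=
  {ideal_quot ideal_gen rs}.

Section AlgQuot.
Variables (k : comNzRingType) (A : algType k) (rs : seq A).
Hypothesis rsP : 1 \notin ideal_gen rs.
Local Notation Q := (alg_quot rsP).

HB.instance Definition _ := GRing.Zmodule.on Q.
HB.instance Definition _ := EqQuotient.on Q.

Definition alg_pi (u : A) : Q := \pi_({ideal_quot ideal_gen rs}) u.

Lemma alg_pi_eq u v : (alg_pi u == alg_pi v) = (u - v \in ideal_gen rs).
Proof. by rewrite /alg_pi piE Quotient.equivE. Qed.

Lemma alg_piP (x : Q) : exists u, x = alg_pi u.
Proof. by exists (repr x); rewrite /alg_pi reprK. Qed.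

Lemma alg_reprP u : repr (alg_pi u) - u \in ideal_gen rs.
Proof. by rewrite -alg_pi_eq /alg_pi reprK. Qed.

Fact alg_pi_zmod_morphism : zmod_morphism alg_pi.
Proof. by move=> u v; rewrite /alg_pi !piE. Qed.

HB.instance Definition _ :=
  GRing.isZmodMorphism.Build A Q alg_pi alg_pi_zmod_morphism.

(* Locked, so that unification does not unfold the quotient. *)
Definition quot_one : Q := locked (alg_pi 1).
Definition quot_mul (x y : Q) : Q := locked (alg_pi (repr x * repr y)).
Definition quot_scale (c : k) (x : Q) : Q := locked (alg_pi (c *: repr x)).

Lemma quot_oneE : quot_one = alg_pi 1.
Proof. by rewrite /quot_one -lock. Qed.

Lemma quot_mulE u v : quot_mul (alg_pi u) (alg_pi v) = alg_pi (u * v).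
Proof.
rewrite /quot_mul -lock; apply/eqP; rewrite alg_pi_eq.
set u' := repr _; set v' := repr _.
rewrite (_ : _ - _ = (u' - u) * v' + u * (v' - v)).
  by apply: rpredD; [apply: ideal_genMr|apply: ideal_genMl]; apply: alg_reprP.
by rewrite mulrBl mulrBr addrA subrK.
Qed.

Lemma quot_scaleE c u : quot_scale c (alg_pi u) = alg_pi (c *: u).
Proof.
rewrite /quot_scale -lock; apply/eqP.
by rewrite alg_pi_eq -scalerBr -mulr_algl ideal_genMl ?alg_reprP.
Qed.

Fact quot_mulA : associative quot_mul.
Proof.
move=> x y z; have [[[u ->] [v ->]] [w ->]] := (alg_piP x, alg_piP y, alg_piP z).
by rewrite !quot_mulE mulrA.
Qed.

Fact quot_mul1 : left_id quot_one quot_mul.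
Proof. by move=> x; have [u ->] := alg_piP x; rewrite quot_oneE quot_mulE mul1r. Qed.

Fact quot_mulr1 : right_id quot_one quot_mul.
Proof. by move=> x; have [u ->] := alg_piP x; rewrite quot_oneE quot_mulE mulr1. Qed.

Fact quot_mulDl : left_distributive quot_mul +%R.
Proof.
move=> x y z; have [[[u ->] [v ->]] [w ->]] := (alg_piP x, alg_piP y, alg_piP z).
by rewrite -raddfD !quot_mulE mulrDl raddfD.
Qed.

Fact quot_mulDr : right_distributive quot_mul +%R.
Proof.
move=> x y z; have [[[u ->] [v ->]] [w ->]] := (alg_piP x, alg_piP y, alg_piP z).
by rewrite -raddfD !quot_mulE mulrDr raddfD.
Qed.

Fact quot_oner_neq0 : quot_one != 0.
Proof. by rewrite quot_oneE -(raddf0 alg_pi) alg_pi_eq subr0. Qed.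

HB.instance Definition _ := GRing.Zmodule_isNzRing.Build Q
  quot_mulA quot_mul1 quot_mulr1 quot_mulDl quot_mulDr quot_oner_neq0.

Fact quot_scalerA a b x : quot_scale a (quot_scale b x) = quot_scale (a * b) x.
Proof. by have [u ->] := alg_piP x; rewrite !quot_scaleE scalerA. Qed.

Fact quot_scale1r : left_id 1 quot_scale.
Proof. by move=> x; have [u ->] := alg_piP x; rewrite quot_scaleE scale1r. Qed.

Fact quot_scalerDr : right_distributive quot_scale +%R.
Proof.
move=> c x y; have [[u ->] [v ->]] := (alg_piP x, alg_piP y).
by rewrite -raddfD !quot_scaleE scalerDr raddfD.
Qed.

Fact quot_scalerDl x : {morph quot_scale^~ x : a b / a + b}.
Proof.
by move=> a b; have [u ->] := alg_piP x; rewrite !quot_scaleE scalerDl raddfD.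
Qed.

HB.instance Definition _ := GRing.Zmodule_isLmodule.Build k Q
  quot_scalerA quot_scale1r quot_scalerDr quot_scalerDl.

Lemma alg_pi1 : alg_pi 1 = 1. Proof. by rewrite -quot_oneE. Qed.

Lemma alg_piM u v : alg_pi (u * v) = alg_pi u * alg_pi v.
Proof. by rewrite -quot_mulE. Qed.

Lemma alg_piZ c u : alg_pi (c *: u) = c *: alg_pi u.
Proof. by rewrite -quot_scaleE. Qed.

Fact quot_scalerAl (c : k) (x y : Q) : c *: (x * y) = (c *: x) * y.
Proof.
have [[u ->] [v ->]] := (alg_piP x, alg_piP y).
by rewrite -alg_piM -!alg_piZ -alg_piM scalerAl.
Qed.

Fact quot_scalerAr (c : k) (x y : Q) : c *: (x * y) = x * (c *: y).
Proof.
have [[u ->] [v ->]] := (alg_piP x, alg_piP y).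
by rewrite -alg_piM -!alg_piZ -alg_piM scalerAr.
Qed.

HB.instance Definition _ := GRing.Lmodule_isLalgebra.Build k Q quot_scalerAl.
HB.instance Definition _ := GRing.Lalgebra_isAlgebra.Build k Q quot_scalerAr.

Fact alg_pi_monoid_morphism : monoid_morphism alg_pi.
Proof. by split; [exact: alg_pi1|exact: alg_piM]. Qed.

HB.instance Definition _ :=
  GRing.isMonoidMorphism.Build A Q alg_pi alg_pi_monoid_morphism.
HB.instance Definition _ := GRing.isScalable.Build k A Q *:%R alg_pi alg_piZ.

End AlgQuot.

Section C.
Variables (k : comNzRingType) (alpha beta q : k).

Local Notation F := (free_algebra k bool).
Local Notation x := (free_gen k false).
Local Notation y := (free_gen k true).

Definition C_relations : seq (free_algebra k bool) :=
  [:: x ^+ 2 - alpha%:A; y ^+ 2 - beta%:A; x * y + y * x - q%:A].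

(* The ideal of C_relations is proper because the relations hold for the
   matrices of left multiplication by x and y in the expected basis
   1, x, y, xy. *)
Local Definition mx4 (s : seq (seq k)) : 'M[k]_4 :=
  \matrix_(i, j) nth 0 (nth [::] s i) j.

Local Definition C_Mx : 'M[k]_4 :=
  mx4 [:: [:: 0; alpha; 0; 0]; [:: 1; 0; 0; 0];
          [:: 0; 0; 0; alpha]; [:: 0; 0; 1; 0]].

Local Definition C_My : 'M[k]_4 :=
  mx4 [:: [:: 0; q; beta; 0]; [:: 0; 0; 0; - beta];
          [:: 1; 0; 0; q]; [:: 0; -1; 0; 0]].

Fact C_Mx2 : C_Mx ^+ 2 = alpha%:A.
Proof.
apply/matrixP => i j; rewrite !mxE !big_ord_recr big_ord0 /= !mxE /=.
by case: i => [[|[|[|[|//]]]] ?]; case: j => [[|[|[|[|//]]]] ?];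
  rewrite /= ?mulr0n ?mulr1n; ring.
Qed.

Fact C_My2 : C_My ^+ 2 = beta%:A.
Proof.
apply/matrixP => i j; rewrite !mxE !big_ord_recr big_ord0 /= !mxE /=.
by case: i => [[|[|[|[|//]]]] ?]; case: j => [[|[|[|[|//]]]] ?];
  rewrite /= ?mulr0n ?mulr1n; ring.
Qed.

Fact C_MxMy : C_Mx * C_My + C_My * C_Mx = q%:A.
Proof.
apply/matrixP => i j; rewrite !mxE !big_ord_recr !big_ord0 /= !mxE /=.
by case: i => [[|[|[|[|//]]]] ?]; case: j => [[|[|[|[|//]]]] ?];
  rewrite /= ?mulr0n ?mulr1n; ring.
Qed.

Local Definition C_word (m : {fmonom bool}) : 'M[k]_4 :=
  \prod_(i <- (m : seq bool)) (if i then C_My else C_Mx).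

Fact C_word_mmorphism : mmorphism C_word.
Proof.
split=> [m1 m2|]; last by rewrite /C_word fm1 big_nil.
by rewrite /C_word fmM big_cat.
Qed.

HB.instance Definition _ :=
  isMultiplicative.Build {fmonom bool} 'M[k]_4 C_word C_word_mmorphism.

Local Definition C_rep : {malg k[{fmonom bool}]} -> 'M[k]_4 :=
  mmap (@scalar_mx k 4) C_word.

Fact C_repM : {morph C_rep : u v / u * v}.
Proof.
have [] // := @commr_mmap_is_multiplicative _ _ _ (@scalar_mx k 4) C_word.
by move=> g m m'; apply/esym/scalar_mxC.
Qed.

Fact C_rep1 : C_rep 1 = 1.
Proof. exact: mmap1. Qed.

Fact C_repD : {morph C_rep : u v / u + v}.
Proof. exact: mmapD. Qed.

Fact C_repB : {morph C_rep : u v / u - v}.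
Proof. exact: mmapB. Qed.

Fact C_repA c : C_rep c%:A = c%:A.
Proof. by rewrite /C_rep mmapZ mmap1 mulr1 scalemx1. Qed.

Fact C_rep_gen i : C_rep (free_gen k i) = if i then C_My else C_Mx.
Proof. by rewrite /C_rep /free_gen mmapU mul1r /C_word fmU big_seq1. Qed.

Fact C_ideal_proper : 1 \notin ideal_gen C_relations.
Proof.
apply/negP => /ideal_genP /(_ (fun u => C_rep u = 0)) I1.
suff : C_rep 1 = 0 by rewrite C_rep1 => /eqP; rewrite oner_eq0.
apply: I1 => [|r].
  split=> [|u v u0 v0|a b u u0]; first exact: mmap0.
    by rewrite C_repD u0 v0 addr0.
  by rewrite !C_repM u0 mulr0 mul0r.
rewrite !inE => /or3P[] /eqP ->.
- by rewrite C_repB C_repA expr2 C_repM C_rep_gen -expr2 C_Mx2 subrr.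
- by rewrite C_repB C_repA expr2 C_repM C_rep_gen -expr2 C_My2 subrr.
- by rewrite C_repB C_repA C_repD !C_repM !C_rep_gen C_MxMy subrr.
Qed.

Definition C : algType k := alg_quot C_ideal_proper.

End C.

(* Main.v *)
Require Import Defs.
From HB Require Import structures.
From mathcomp Require Import all_boot all_algebra.
From mathcomp Require Import ssrAC ring.
From mathcomp Require Import monalg.

Set Implicit Arguments.
Unset Strict Implicit.
Unset Printing Implicit Defensive.

Import GRing.Theory.
Local Open Scope ring_scope.

(** The algebra C_q is a generalized quaternion algebra.  Completing the square,
    z := y - (q / 2 alpha) x anticommutes with x and satisfies
    z^2 = gamma_q := (4 alpha beta - q^2) / (4 alpha), and 1, x, z, xz is a basis
    of C_q.  So the theorem is about algebras A with a basis 1, x, z, xz where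
    x^2 = alpha, z^2 = gamma <> 0 and zx = -xz, and everything follows from one
    criterion (C_isoP): C_q is isomorphic to A if and only if gamma_q is gamma
    times a value of the norm form c^2 - alpha d^2 of k(sqrt alpha).

    If the criterion holds, then (c + d x) z anticommutes with x and has square
    gamma (c^2 - alpha d^2) = gamma_q (twisted_pair), so the universal property of
    C_q (C_lift) gives a morphism from C_q to A; it is injective because the
    relations of a quaternion pair force 1, x, z, xz to be independent (quat_eq0),
    and surjective because c + d x is invertible.

    Conversely a morphism sends the basis of C_q to a pair X, Z of A with
    X^2 = alpha, Z^2 = gamma_q and ZX = -XZ.  Here an elementary form of the
    Skolem-Noether theorem applies: x + X and x - X intertwine X with x and with
    -x respectively, their squares are scalars, and these two scalars add up to
    4 alpha, so one of the two elements is invertible.  Conjugating Z by it gives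
    an element that has square gamma_q and anticommutes with x, and such an element
    lies in k(x) z, so gamma_q is gamma times a norm (norm_of_pair).

    Part (1) is the criterion for A = C_h, since
    gamma_q / gamma_h = (q^2 - 4 alpha beta) / (h^2 - 4 alpha beta).  Part (2) is
    the criterion for A = M_2(k), which has such a basis with gamma = 1; the factor
    between gamma_q and q^2 - 4 alpha beta is -4 alpha, the norm of 2 sqrt alpha. *)

(** * Quaternion pairs and their multiplication table *)

Section QuaternionPair.
Variables (k : fieldType) (A : algType k) (alpha gamma : k) (x z : A).

Definition quaternion_pair : Prop :=
  [/\ x ^+ 2 = alpha%:A, z ^+ 2 = gamma%:A & z * x = - (x * z)].

Definition quat (s t u v : k) : A :=
  s%:A + t *: x + u *: z + v *: (x * z).

Definition quat_spanning : Prop :=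
  forall w : A, exists s t u v, w = quat s t u v.

Lemma quat_scalar s : s%:A = quat s 0 0 0.
Proof. by rewrite /quat !scale0r !addr0. Qed.

Lemma quatx : x = quat 0 1 0 0.
Proof. by rewrite /quat !scale0r scale1r !addr0 add0r. Qed.

Lemma quatz : z = quat 0 0 1 0.
Proof. by rewrite /quat !scale0r scale1r addr0 !add0r. Qed.

Lemma quatD s t u v s' t' u' v' :
  quat s t u v + quat s' t' u' v' = quat (s + s') (t + t') (u + u') (v + v').
Proof.
by rewrite /quat !scalerDl [LHS](AC (4*4) ((1*5)*(2*6)*(3*7)*(4*8))).
Qed.

Lemma quatZ c s t u v :
  c *: quat s t u v = quat (c * s) (c * t) (c * u) (c * v).
Proof. by rewrite /quat !scalerDr !scalerA. Qed.

Lemma quatN s t u v : - quat s t u v = quat (- s) (- t) (- u) (- v).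
Proof. by rewrite -scaleN1r quatZ !mulN1r. Qed.

Hypothesis xzP : quaternion_pair.

Lemma mulx_quat s t u v :
  x * quat s t u v = quat (alpha * t) s (alpha * v) u.
Proof.
have [xx _ _] := xzP.
rewrite /quat !mulrDr -!scalerAr mulr1 mulrA -expr2 xx -scalerAl mul1r !scalerA.
by rewrite ![_ * alpha]mulrC [LHS](ACl (2*1*4*3)).
Qed.

Lemma mulz_quat s t u v :
  z * quat s t u v = quat (gamma * u) (- (gamma * v)) s (- t).
Proof.
have [_ zz zx] := xzP.
rewrite /quat !mulrDr -!scalerAr mulr1 mulrA zx mulNr -mulrA -expr2 zz.
by rewrite -scalerAr mulr1 !scalerN !scalerA !scaleNr ![_ * gamma]mulrC
  [LHS](ACl (3*4*1*2)).
Qed.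

(** This table turns identities between noncommuting elements into polynomial
    identities between their coordinates in k, which [ring] and [field] decide. *)
Lemma quatM s t u v s' t' u' v' :
  quat s t u v * quat s' t' u' v' =
  quat (s * s' + alpha * t * t' + gamma * u * u' - alpha * gamma * v * v')
       (s * t' + t * s' - gamma * u * v' + gamma * v * u')
       (s * u' + u * s' + alpha * t * v' - alpha * v * t')
       (s * v' + v * s' + t * u' - u * t').
Proof.
rewrite {1}/quat !mulrDl -!scalerAl mul1r -[x * z * _]mulrA.
by rewrite mulz_quat !mulx_quat !quatZ !quatD; congr quat; ring.
Qed.

Hypotheses (two_neq0 : (2 : k) != 0) (alpha_neq0 : alpha != 0)
  (gamma_neq0 : gamma != 0).

Let double0 (c : k) : c *+ 2 = 0 -> c = 0.
Proof.
by move/eqP; rewrite -mulr_natr mulf_eq0 (negPf two_neq0) orbF => /eqP.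
Qed.

(** Independence needs no dimension count.  Since x and z are invertible and
    2 <> 0, averaging over conjugation by x separates the part in k + k x from the
    part in k z + k xz; averaging over conjugation by z then separates k from
    k x. *)
Lemma quat_eq0 s t u v :
  quat s t u v = 0 -> [/\ s = 0, t = 0, u = 0 & v = 0].
Proof.
have xK w : x * w = 0 -> w = 0.
  have [xx _ _] := xzP; move/(congr1 ( *%R x)).
  rewrite mulrA -expr2 xx mulr0 -scalerAl mul1r => /eqP.
  by rewrite scaler_eq0 (negPf alpha_neq0) => /eqP.
have zK w : z * w = 0 -> w = 0.
  have [_ zz _] := xzP; move/(congr1 ( *%R z)).
  rewrite mulrA -expr2 zz mulr0 -scalerAl mul1r => /eqP.
  by rewrite scaler_eq0 (negPf gamma_neq0) => /eqP.
have s0 a : quat a 0 0 0 = 0 -> a = 0.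
  by rewrite -quat_scalar => /eqP; rewrite scaler_eq0 oner_eq0 orbF => /eqP.
have st0 a b : quat a b 0 0 = 0 -> a = 0 /\ b = 0.
  move=> ab0.
  have a0 : a = 0.
    apply/double0/s0/zK.
    have: z * quat a b 0 0 + quat a b 0 0 * z = 0.
      by rewrite ab0 mul0r mulr0 addr0.
    rewrite [X in _ + _ * X]quatz quatM !mulz_quat quatD => <-.
    by congr quat; ring.
  split=> //; apply/s0/xK; rewrite mulx_quat -ab0 a0; congr quat; ring.
move=> q0.
(* For every w, x w x + alpha w is 2 alpha times the component of w in k + k x. *)
have xqx0 : x * (quat s t u v * x) + alpha *: quat s t u v = 0.
  by rewrite q0 mul0r mulr0 scaler0 addr0.
have [sa0 ta0] : alpha * s *+ 2 = 0 /\ alpha * t *+ 2 = 0.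
  apply: st0; rewrite -[RHS]xqx0 [X in _ * (_ * X)]quatx quatM mulx_quat.
  by rewrite quatZ quatD; congr quat; ring.
have cancel_alpha c : alpha * c *+ 2 = 0 -> c = 0.
  by move/double0/eqP; rewrite mulf_eq0 (negPf alpha_neq0) => /eqP.
have [ss tt] := (cancel_alpha _ sa0, cancel_alpha _ ta0).
(* Multiplication by z moves the remaining part k z + k xz into k + k x. *)
have [|uu /eqP] := st0 u (- v); last by rewrite oppr_eq0 => /eqP.
by apply: zK; rewrite -[RHS]q0 ss tt mulz_quat; congr quat; ring.
Qed.

Lemma quat_inj s t u v s' t' u' v' :
  quat s t u v = quat s' t' u' v' -> [/\ s = s', t = t', u = u' & v = v'].
Proof.
move/eqP; rewrite -subr_eq0 quatN quatD => /eqP /quat_eq0[].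
by do 4![move/subr0_eq->].
Qed.

(** * The norm condition is necessary *)

Section Norm.
Hypothesis alpha_nonsquare : forall r, r ^+ 2 != alpha.

(** If the scalar coordinate s were nonzero, the coordinates 2st, 2su, 2sv of the
    square would make the element a scalar, that is, a square root of alpha
    in k. *)
Lemma quat_sqrt_alpha s t u v : quat s t u v ^+ 2 = alpha%:A ->
  s = 0 /\
  alpha * t ^+ 2 = alpha - gamma * u ^+ 2 + alpha * gamma * v ^+ 2.
Proof.
rewrite expr2 quatM quat_scalar => /quat_inj[e1 e2 e3 e4].
suff s0 : s = 0 by split=> //; rewrite -[X in _ = X - _ + _]e1 s0; ring.
apply/eqP/negPn/negP => s_neq0.
have cancel_s (c : k) : s * c *+ 2 = 0 -> c = 0.
  by move/double0/eqP; rewrite mulf_eq0 (negPf s_neq0) => /eqP.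
have t0 : t = 0 by apply: cancel_s; rewrite -[RHS]e2; ring.
have u0 : u = 0 by apply: cancel_s; rewrite -[RHS]e3; ring.
have v0 : v = 0 by apply: cancel_s; rewrite -[RHS]e4; ring.
by case/eqP: (alpha_nonsquare s); rewrite -[RHS]e1 t0 u0 v0; ring.
Qed.

Hypothesis spanA : quat_spanning.

(** The elements that anticommute with x are the (c + d x) z, and
    z (c + d x) = (c - d x) z turns the square of such an element into a norm. *)
Lemma norm_of_anticommuting w delta :
  w * x = - (x * w) -> w ^+ 2 = delta%:A ->
  exists c d, delta = gamma * (c ^+ 2 - alpha * d ^+ 2).
Proof.
have [s [t [u [v ->]]]] := spanA w; rewrite {1}quatx mulx_quat quatM quatN.
case/quat_inj=> st ss _ _.
rewrite expr2 quatM quat_scalar => /quat_inj[e1 _ _ _].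
exists u, v; rewrite -e1.
have t0 : alpha * t = 0.
  apply: double0; rewrite mulr2n -[X in X + _]opprK -st; ring.
have s0 : s = 0.
  apply: double0; rewrite mulr2n -[X in X + _]opprK -ss; ring.
by rewrite t0 s0; ring.
Qed.

(** The element w := x + X satisfies x w = w X and X w = w x because both squares
    are alpha.  Since w^2 = n, the element w Z w is n times the conjugate of Z
    by w; its square is n^2 delta, and n^2 is then divided out. *)
Lemma norm_of_conjugator X Z delta n : n != 0 ->
    X ^+ 2 = alpha%:A -> Z ^+ 2 = delta%:A -> Z * X = - (X * Z) ->
    (x + X) ^+ 2 = n%:A ->
  exists c d, delta = gamma * (c ^+ 2 - alpha * d ^+ 2).
Proof.
have [xx _ _] := xzP.
move=> n_neq0 XX ZZ ZX; set w := x + X => ww.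
have xw : x * w = w * X.
  by rewrite mulrDr mulrDl -!expr2 xx XX addrC.
have Xw : X * w = w * x.
  by rewrite mulrDr mulrDl -!expr2 xx XX addrC.
have [||c [d ncd]] := @norm_of_anticommuting (w * Z * w) (n ^+ 2 * delta).
- rewrite -[LHS]mulrA -Xw !mulrA -[w * Z * X]mulrA ZX xw.
  by rewrite mulrN mulNr !mulrA.
- rewrite expr2 -!mulrA [w * (w * _)]mulrA -expr2 ww -scalerAl mul1r.
  rewrite -!scalerAr [Z * (Z * _)]mulrA -expr2 ZZ -scalerAl mul1r -scalerAr.
  by rewrite -expr2 ww !scalerA; congr (_ *: _); ring.
- exists (c / n), (d / n); rewrite !expr_div_n mulrA -mulrBl mulrA -ncd.
  by rewrite mulrC mulKf ?expf_neq0.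
Qed.

(** The scalars (x + X)^2 = 2 alpha (1 + t) and (x - X)^2 = 2 alpha (1 - t), for t
    the coordinate of X on x, do not both vanish. *)
Lemma norm_of_pair (X Z : A) (delta : k) :
    X ^+ 2 = alpha%:A -> Z ^+ 2 = delta%:A -> Z * X = - (X * Z) ->
  exists c d, delta = gamma * (c ^+ 2 - alpha * d ^+ 2).
Proof.
move=> XX ZZ ZX.
have [s [t [u [v EX]]]] := spanA X.
have [s0 et] : s = 0 /\
    alpha * t ^+ 2 = alpha - gamma * u ^+ 2 + alpha * gamma * v ^+ 2.
  by apply: quat_sqrt_alpha; rewrite -EX.
have [t1|t1] := eqVneq (1 + t) 0.
  apply: (@norm_of_conjugator (- X) Z delta (2 * alpha * (1 - t))).
  - have -> : 1 - t = 2 - (1 + t) by ring.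
    by rewrite t1 subr0 !mulf_neq0.
  - by rewrite sqrrN.
  - exact: ZZ.
  - by rewrite mulrN mulNr ZX.
  - rewrite EX quatN {1}quatx quatD expr2 quatM quat_scalar s0.
    by congr quat; ring: et.
apply: (@norm_of_conjugator X Z delta (2 * alpha * (1 + t))) => //.
  by rewrite !mulf_neq0.
rewrite EX {1}quatx quatD expr2 quatM quat_scalar s0.
by congr quat; ring: et.
Qed.

End Norm.
End QuaternionPair.

(** * Universal properties of quotients and of free algebras *)

Section QuotientLift.
Variables (k : comNzRingType) (A B : algType k) (rs : seq A).
Hypothesis rsP : 1 \notin ideal_gen rs.

Lemma quotient_lift (g : {lrmorphism A -> B}) :
    (forall r, r \in rs -> g r = 0) ->
  exists f : {lrmorphism alg_quot rsP -> B}, forall u, f (alg_pi rsP u) = g u.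
Proof.
move=> g0.
have g_ideal u : u \in ideal_gen rs -> g u = 0.
  move=> /ideal_genP/(_ (fun v => g v = 0)); apply=> //.
  split=> [|v w /= v0 w0|a b v /= v0]; first exact: rmorph0.
    by rewrite rmorphD /= v0 w0 addr0.
  by rewrite !rmorphM /= v0 mulr0 mul0r.
pose f (w : alg_quot rsP) := g (repr w).
have fE u : f (alg_pi rsP u) = g u.
  by apply/eqP; rewrite -subr_eq0 -rmorphB /= g_ideal ?alg_reprP.
have fB : zmod_morphism f.
  move=> v w; have [[a ->] [b ->]] := (alg_piP v, alg_piP w).
  by rewrite -raddfB !fE raddfB.
have fM : monoid_morphism f.
  split=> [|v w]; first by rewrite -alg_pi1 fE rmorph1.
  have [[a ->] [b ->]] := (alg_piP v, alg_piP w).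
  by rewrite -alg_piM !fE rmorphM.
have fZ : scalable f.
  by move=> c w; have [a ->] := alg_piP w; rewrite -alg_piZ !fE linearZ.
pose mB := GRing.isZmodMorphism.Build _ _ f fB.
pose mM := GRing.isMonoidMorphism.Build _ _ f fM.
pose mZ := GRing.isScalable.Build _ _ _ _ f fZ.
pose F : {lrmorphism alg_quot rsP -> B} := HB.pack f mB mM mZ.
by exists F.
Qed.

End QuotientLift.

Section FreeAlgebra.
Variables (k : comNzRingType) (I : choiceType).

Definition eval_word (B : algType k) (g : I -> B) (m : {fmonom I}) : B :=
  \prod_(i <- (m : seq I)) g i.

Fact eval_word_mmorphism (B : algType k) (g : I -> B) :
  mmorphism (eval_word g).
Proof.
split=> [m1 m2|]; last by rewrite /eval_word fm1 big_nil.
by rewrite /eval_word fmM big_cat.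
Qed.

HB.instance Definition _ (B : algType k) (g : I -> B) :=
  isMultiplicative.Build {fmonom I} B (eval_word g) (eval_word_mmorphism g).

Lemma free_algebra_lift (B : algType k) (g : I -> B) :
  exists f : {lrmorphism free_algebra k I -> B},
    forall i, f (free_gen k i) = g i.
Proof.
pose f (u : free_algebra k I) : B :=
  mmap (in_alg B) (eval_word g) (u : {malg k[{fmonom I}]}).
have fB : zmod_morphism f by move=> u v; exact: mmapB.
have fM : monoid_morphism f.
  split; first exact: mmap1.
  have [] // := @commr_mmap_is_multiplicative _ _ _ (in_alg B) (eval_word g).
  by move=> u m m'; rewrite /GRing.comm /= -scalerAl -scalerAr mul1r mulr1.
have fZ : scalable f.
  by move=> c u; rewrite /f mmapZ /= -scalerAl mul1r.
pose mB := GRing.isZmodMorphism.Build _ _ f fB.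
pose mM := GRing.isMonoidMorphism.Build _ _ f fM.
pose mZ := GRing.isScalable.Build _ _ _ _ f fZ.
pose F : {lrmorphism free_algebra k I -> B} := HB.pack f mB mM mZ.
exists F => i; rewrite /F /= /f /free_gen mmapU /= scale1r mul1r.
by rewrite /eval_word fmU big_seq1.
Qed.

Lemma free_algebra_ind (P : free_algebra k I -> Prop) :
    P 1 -> (forall u v, P u -> P v -> P (u + v)) ->
    (forall c u, P u -> P (c *: u)) ->
    (forall i u, P u -> P (free_gen k i * u)) ->
  forall u, P u.
Proof.
move=> P1 PD PZ Pgen u.
have Pword (m : seq I) : P (<< FMonom m >> : free_alg k I).
  elim: m => [|i m IHm].
    have -> : FMonom [::] = mone :> {fmonom I} by rewrite -fmoneE.
    exact: P1.
  suff -> : (<< FMonom (i :: m) >> : free_alg k I)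
            = free_gen k i * (<< FMonom m >> : free_alg k I) by exact: Pgen.
  rewrite [RHS]malgM_def fgmulUU mul1r; congr mkmalgU.
  by apply/eqP; rewrite fmP fmM fmU.
rewrite (monalgE (u : {malg k[{fmonom I}]})).
elim/big_ind: _ => //.
- by rewrite -(scale0r 1); apply: PZ.
- case=> m _.
  suff -> : << u@_(FMonom m) *g FMonom m >> =
      u@_(FMonom m) *: << FMonom m >> :> {malg k[{fmonom I}]} by exact/PZ/Pword.
  by apply/malgP=> m'; rewrite mcoeffZ !mcoeffU mulrnAr mulr1.
Qed.

End FreeAlgebra.

(** * The presented algebras as quaternion algebras *)

Section Presentation.
Variables (k : comNzRingType) (alpha beta q : k).

Definition satisfies_C (A : algType k) (x y : A) : Prop :=
  [/\ x ^+ 2 = alpha%:A, y ^+ 2 = beta%:A & x * y + y * x = q%:A].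

Definition Cx : C alpha beta q := alg_pi _ (free_gen k false).
Definition Cy : C alpha beta q := alg_pi _ (free_gen k true).

Lemma C_satisfies_C : satisfies_C Cx Cy.
Proof.
have rel r s : r - s \in C_relations alpha beta q ->
    alg_pi (C_ideal_proper alpha beta q) r = alg_pi _ s.
  move=> rs; apply/eqP; rewrite alg_pi_eq.
  by apply/ideal_genP => J _; apply.
have relA r c : r - c%:A \in C_relations alpha beta q ->
    alg_pi (C_ideal_proper alpha beta q) r = c%:A.
  by move/rel->; rewrite linearZ rmorph1.
(* Abstract entries keep the comparison of distinct relations from being evaluated
   in the free algebra. *)
have mem3 (T : eqType) (a b c : T) :
    [/\ a \in [:: a; b; c], b \in [:: a; b; c] & c \in [:: a; b; c]].
  by split; rewrite !inE eqxx ?orbT.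
have [rel1 rel2 rel3] := mem3 _
  (free_gen k false ^+ 2 - alpha%:A) (free_gen k true ^+ 2 - beta%:A)
  (free_gen k false * free_gen k true + free_gen k true * free_gen k false
     - q%:A).
split.
- by rewrite -rmorphXn; apply: relA; exact: rel1.
- by rewrite -rmorphXn; apply: relA; exact: rel2.
- by rewrite -!rmorphM -rmorphD; apply: relA; exact: rel3.
Qed.

Lemma C_lift (A : algType k) (x y : A) : satisfies_C x y ->
  exists f : {lrmorphism C alpha beta q -> A}, f Cx = x /\ f Cy = y.
Proof.
move=> [xx yy xy].
have [g gE] := @free_algebra_lift k bool A (fun i => if i then y else x).
have [|f fE] := @quotient_lift k _ A _ (C_ideal_proper alpha beta q) g.
  have gA c : g c%:A = c%:A by rewrite linearZ rmorph1.
  move=> r; rewrite !inE => /or3P[] /eqP ->; rewrite rmorphB /= gA.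
  - by rewrite rmorphXn /= gE xx subrr.
  - by rewrite rmorphXn /= gE yy subrr.
  - by rewrite rmorphD !rmorphM /= !gE xy subrr.
by exists f; rewrite !fE !gE.
Qed.

Lemma C_ind (P : C alpha beta q -> Prop) :
    P 1 -> (forall u v, P u -> P v -> P (u + v)) ->
    (forall c u, P u -> P (c *: u)) ->
    (forall u, P u -> P (Cx * u)) -> (forall u, P u -> P (Cy * u)) ->
  forall u, P u.
Proof.
move=> P1 PD PZ Px Py u; have [v ->] := alg_piP u.
elim/free_algebra_ind: v => [|v w Pv Pw|c v Pv|i v Pv].
- by rewrite rmorph1.
- by rewrite rmorphD; apply: PD.
- by rewrite linearZ; apply: PZ.
- by rewrite rmorphM; case: i; [apply: Py|apply: Px].
Qed.

End Presentation.

Section CQuaternion.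
Variables (k : fieldType) (alpha beta q : k).
Hypotheses (two_neq0 : (2 : k) != 0) (alpha_neq0 : alpha != 0).

Local Notation r := (q / (2 * alpha)).
(** The square of [Cz]. *)
Definition C_param : k := (4 * alpha * beta - q ^+ 2) / (4 * alpha).
Definition Cz : C alpha beta q := Cy _ _ _ - r *: Cx _ _ _.

Lemma four_neq0 : (4 : k) != 0.
Proof. by rewrite (_ : 4 = 2 * 2) ?mulf_neq0 //; ring. Qed.

Lemma C_quaternion_pair (A : algType k) (x y : A) :
  satisfies_C alpha beta q x y -> quaternion_pair alpha C_param x (y - r *: x).
Proof.
move=> [xx yy xy].
have yx : y * x = q%:A - x * y by rewrite -xy addrAC subrr add0r.
split=> //.
  rewrite expr2 mulrBl !mulrBr -!scalerAl -!scalerAr -!expr2 xx yy yx.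
  rewrite scalerBr !scalerA !opprB.
  rewrite [LHS](AC (1*2*2) ((1*3*4)*(2*5))) /= subrr addr0 -scalerBl -scalerDl.
  congr (_ *: _); rewrite /C_param; field.
  by rewrite alpha_neq0 two_neq0 four_neq0.
rewrite mulrBl mulrBr -scalerAl -scalerAr -expr2 xx yx opprB scalerA.
rewrite [LHS](AC (2*1) ((1*3)*2)) /= -scalerBl; congr (_ *: _ + _).
by field; rewrite alpha_neq0 two_neq0.
Qed.

Lemma quaternion_pair_satisfies_C (A : algType k) (x z : A) :
  quaternion_pair alpha C_param x z -> satisfies_C alpha beta q x (z + r *: x).
Proof.
move=> xzP; have [xx _ _] := xzP.
have -> : z + r *: x = quat x z 0 r 1 0.
  rewrite [X in X + _ = _](quatz x z) [X in _ + _ *: X](quatx x z).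
  by rewrite quatZ quatD; congr quat; ring.
split=> //.
  rewrite expr2 (quatM xzP) (quat_scalar x z); congr quat; rewrite /C_param; field;
    by rewrite ?alpha_neq0 ?two_neq0 ?four_neq0.
rewrite [X in X * _ + _](quatx x z) [X in _ + _ * X](quatx x z).
rewrite !(quatM xzP) quatD (quat_scalar x z).
by congr quat; field; rewrite ?alpha_neq0 ?two_neq0 ?four_neq0.
Qed.

(** The span of 1, x, z, xz contains 1 and is stable under left multiplication by
    x and by y = z + (q / 2 alpha) x. *)
Lemma C_spanning : quat_spanning (Cx alpha beta q) Cz.
Proof.
have xzP : quaternion_pair alpha C_param (Cx alpha beta q) Cz :=
  C_quaternion_pair (C_satisfies_C alpha beta q).
elim/C_ind => [|_ _ [s [t [u [v ->]]]] [s' [t' [u' [v' ->]]]]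
  |c _ [s [t [u [v ->]]]]|_ [s [t [u [v ->]]]]|_ [s [t [u [v ->]]]]].
- by rewrite -(scale1r 1) (quat_scalar (Cx _ _ _) Cz); do 4!eexists.
- by rewrite quatD; do 4!eexists.
- by rewrite quatZ; do 4!eexists.
- by rewrite (mulx_quat xzP); do 4!eexists.
- rewrite -(subrK (r *: Cx _ _ _) (Cy _ _ _)) mulrDl -scalerAl.
  by rewrite -/Cz (mulx_quat xzP) (mulz_quat xzP) quatZ quatD; do 4!eexists.
Qed.

End CQuaternion.

(** * The isomorphism criterion *)

Section Transport.
Variables (k : fieldType) (A B : algType k) (f : {lrmorphism A -> B}).

Lemma quat_morph x z s t u v :
  f (quat x z s t u v) = quat (f x) (f z) s t u v.
Proof. by rewrite /quat !linearD !linearZ /= rmorph1 rmorphM. Qed.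

Lemma quaternion_pair_morph (alpha gamma : k) x z :
  quaternion_pair alpha gamma x z -> quaternion_pair alpha gamma (f x) (f z).
Proof.
move=> [xx zz zx]; split.
- by rewrite -rmorphXn /= xx linearZ /= rmorph1.
- by rewrite -rmorphXn /= zz linearZ /= rmorph1.
- by rewrite -!rmorphM /= zx rmorphN.
Qed.

End Transport.

Lemma inj_surj_bijective (T : choiceType) (U : eqType) (f : T -> U) :
  injective f -> (forall u, exists t, f t = u) -> bijective f.
Proof.
move=> f_inj f_surj.
have f_surjb u : exists t, f t == u by have [t <-] := f_surj u; exists t.
have fK u : f (xchoose (f_surjb u)) = u by apply/eqP/(xchooseP (f_surjb u)).
by exists (fun u => xchoose (f_surjb u)) => // t; apply: f_inj.
Qed.

Lemma twisted_pair (k : fieldType) (A : algType k) (alpha gamma c d : k)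
    (x z : A) :
    quaternion_pair alpha gamma x z ->
  quaternion_pair alpha (gamma * (c ^+ 2 - alpha * d ^+ 2))
    x (quat x z 0 0 c d).
Proof.
move=> xzP; have [xx _ _] := xzP; split=> //.
- by rewrite expr2 (quatM xzP) (quat_scalar x z); congr quat; ring.
- rewrite (mulx_quat xzP) [X in _ * X](quatx x z) (quatM xzP) quatN.
  by congr quat; ring.
Qed.

Lemma nonsquare_neq0 (k : fieldType) (alpha : k) :
  (forall r, r ^+ 2 != alpha) -> alpha != 0.
Proof. by move/(_ 0); rewrite expr0n eq_sym. Qed.

Section Classification.
Variables (k : fieldType) (alpha beta q : k).
Hypotheses (two_neq0 : (2 : k) != 0)
  (alpha_nonsquare : forall r, r ^+ 2 != alpha)
  (disc_neq0 : 4 * alpha * beta - q ^+ 2 != 0).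

Let alpha_neq0 : alpha != 0.
Proof. exact: nonsquare_neq0. Qed.

Lemma C_param_neq0 : C_param alpha beta q != 0.
Proof. by rewrite !mulf_neq0 ?invr_eq0 ?mulf_neq0 ?four_neq0. Qed.

Variables (A : algType k) (gamma : k) (x z : A).
Hypotheses (gamma_neq0 : gamma != 0) (xzP : quaternion_pair alpha gamma x z)
  (spanA : quat_spanning x z).

(** A morphism carries Cx, Cz to a pair to which [norm_of_pair] applies.
    Conversely z' := (c + d x) z gives a morphism by [C_lift], and x, z' generate A
    because c + d x is invertible. *)
Theorem C_isoP : algebra_isomorphic (C alpha beta q) A <->
  exists c d, C_param alpha beta q = gamma * (c ^+ 2 - alpha * d ^+ 2).
Proof.
have CP := C_quaternion_pair two_neq0 alpha_neq0 (C_satisfies_C alpha beta q).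
rewrite -/(Cz alpha beta q) in CP.
split=> [[f _]|[c [d normE]]].
  have [fxx fzz fzx] := quaternion_pair_morph f CP.
  exact: (norm_of_pair xzP two_neq0 alpha_neq0 gamma_neq0 alpha_nonsquare spanA
            fxx fzz fzx).
set n := c ^+ 2 - alpha * d ^+ 2 in normE.
have n_neq0 : n != 0.
  by apply: contraNneq C_param_neq0 => n0; rewrite normE n0 mulr0.
pose z' := quat x z 0 0 c d.
have xz'P : quaternion_pair alpha (C_param alpha beta q) x z'.
  by rewrite normE; apply: twisted_pair.
have [f [fx fy]] := C_lift (quaternion_pair_satisfies_C two_neq0 alpha_neq0 xz'P).
have fz : f (Cz alpha beta q) = z'.
  by rewrite /Cz linearB linearZ /= fx fy addrK.
have f_quat s t u v : f (quat (Cx _ _ _) (Cz _ _ _) s t u v) = quat x z' s t u v.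
  by rewrite quat_morph fx fz.
exists f; apply: inj_surj_bijective.
  apply: raddf_inj => w.
  have [s [t [u [v ->]]]] := C_spanning two_neq0 alpha_neq0 w.
  rewrite /= f_quat => /(quat_eq0 xz'P two_neq0 alpha_neq0 C_param_neq0)[-> -> -> ->].
  by rewrite -quat_scalar scale0r.
move=> w; have [s [t [u [v ->]]]] := spanA w.
(* z = (c + d x)^-1 z' and (c + d x)^-1 = (c - d x) / n; w0 is the same expression
   in C_q, hence a preimage of z. *)
pose w0 := quat (Cx alpha beta q) (Cz alpha beta q) 0 0 (c / n) (- d / n).
exists (quat (Cx _ _ _) w0 s t u v).
rewrite quat_morph f_quat fx; congr quat.
rewrite /z' {1}/quat !scale0r !add0r (mulx_quat xzP) !quatZ quatD.
rewrite [RHS](quatz x z); congr quat; rewrite /n; field; exact: n_neq0.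
Qed.

End Classification.

(** * Matrices of size two as a quaternion algebra *)

Section SplitAlgebra.
Variables (k : fieldType) (alpha : k).

Definition mx2 (a b c d : k) : 'M[k]_2 :=
  \matrix_(i, j) nth 0 (nth [::] [:: [:: a; b]; [:: c; d]] i) j.

Lemma mx2E (M : 'M[k]_2) : M = mx2 (M 0 0) (M 0 1) (M 1 0) (M 1 1).
Proof.
apply/matrixP => i j; rewrite mxE.
by case: i => [[|[|//]] i2]; case: j => [[|[|//]] j2] /=;
  congr (M _ _); apply: val_inj.
Qed.

Lemma mx2M a b c d a' b' c' d' : mx2 a b c d * mx2 a' b' c' d' =
  mx2 (a * a' + b * c') (a * b' + b * d') (c * a' + d * c') (c * b' + d * d').
Proof.
apply/matrixP => i j; rewrite !mxE !big_ord_recr big_ord0 /= !mxE add0r.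
by case: i => [[|[|//]] i2]; case: j => [[|[|//]] j2].
Qed.

Lemma mx2D a b c d a' b' c' d' :
  mx2 a b c d + mx2 a' b' c' d' = mx2 (a + a') (b + b') (c + c') (d + d').
Proof.
apply/matrixP => i j; rewrite !mxE.
by case: i => [[|[|//]] i2]; case: j => [[|[|//]] j2].
Qed.

Lemma mx2Z e a b c d : e *: mx2 a b c d = mx2 (e * a) (e * b) (e * c) (e * d).
Proof.
apply/matrixP => i j; rewrite !mxE.
by case: i => [[|[|//]] i2]; case: j => [[|[|//]] j2].
Qed.

Lemma mx2_1 : 1 = mx2 1 0 0 1.
Proof.
apply/matrixP => i j; rewrite !mxE.
by case: i => [[|[|//]] i2]; case: j => [[|[|//]] j2].
Qed.

Definition split_x : 'M[k]_2 := mx2 0 alpha 1 0.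
Definition split_z : 'M[k]_2 := mx2 1 0 0 (-1).

Lemma split_quaternion_pair : quaternion_pair alpha 1 split_x split_z.
Proof.
by split; rewrite /split_x /split_z ?expr2 ?mx2_1 -?scaleN1r !mx2M mx2Z;
  congr mx2; ring.
Qed.

Lemma split_spanning : (2 : k) != 0 -> alpha != 0 -> quat_spanning split_x split_z.
Proof.
move=> two_neq0 alpha_neq0 M; rewrite [M]mx2E.
set a := M 0 0; set b := M 0 1; set c := M 1 0; set d := M 1 1.
exists ((a + d) / 2), ((c + b / alpha) / 2), ((a - d) / 2),
  ((c - b / alpha) / 2).
rewrite /quat /split_x /split_z mx2_1 mx2M !mx2Z !mx2D.
by congr mx2; field; rewrite ?alpha_neq0 ?two_neq0.
Qed.

End SplitAlgebra.

(** * The classification *)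

Lemma irreducible_nonsquare (k : fieldType) (alpha : k) :
  irreducible_poly ('X^2 - alpha%:P) -> forall r, r ^+ 2 != alpha.
Proof.
move=> [_ irr] r; apply/negP => /eqP r2.
have size_p : size ('X^2 - alpha%:P) = 3%N by rewrite size_XnsubC.
have := irr ('X - r%:P).
rewrite size_XsubC dvdp_XsubCl rootE !hornerE r2 subrr eqxx.
by move/(_ isT isT)/eqp_size; rewrite size_XsubC size_p.
Qed.

Theorem theorem3p9 (k : fieldType) (hk : 2%N \notin [pchar k])
    (alpha beta : k)
    (halpha : irreducible_poly ('X^2 - alpha%:P))
    (hbeta : irreducible_poly ('X^2 - beta%:P))
    (q h : k)
    (hq : 4 * alpha * beta - q ^+ 2 != 0)
    (hh : 4 * alpha * beta - h ^+ 2 != 0) :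
  (algebra_isomorphic (C alpha beta q) (C alpha beta h) <->
     exists x y : k, x ^+ 2 - alpha * y ^+ 2 =
       (q ^+ 2 - 4 * alpha * beta) / (h ^+ 2 - 4 * alpha * beta))
  /\
  (algebra_isomorphic (C alpha beta q) 'M[k]_2 <->
     exists x y : k, x ^+ 2 - alpha * y ^+ 2 = q ^+ 2 - 4 * alpha * beta).
Proof.
have two_neq0 : (2 : k) != 0 by move: hk; rewrite inE.
have nonsquare := irreducible_nonsquare halpha.
have alpha_neq0 : alpha != 0 by exact: nonsquare_neq0.
have four0 := four_neq0 two_neq0.
split.
  have hP := C_quaternion_pair two_neq0 alpha_neq0 (C_satisfies_C alpha beta h).
  have isoP := C_isoP two_neq0 nonsquare hq
    (C_param_neq0 two_neq0 nonsquare hh) hP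
    (C_spanning two_neq0 alpha_neq0).
  have hh' : h ^+ 2 - 4 * alpha * beta != 0 by rewrite -opprB oppr_eq0.
  apply: (iff_trans isoP); split=> -[c [d E]]; exists c, d.
    apply: (mulfI (C_param_neq0 two_neq0 nonsquare hh)); rewrite -E /C_param.
    by field; rewrite alpha_neq0 four0 hh'.
  rewrite E /C_param.
  by field; rewrite alpha_neq0 four0 hh'.
have isoP := C_isoP two_neq0 nonsquare hq (oner_neq0 k)
  (split_quaternion_pair alpha) (split_spanning two_neq0 alpha_neq0).
apply: (iff_trans isoP); split=> -[c [d E]].
  (* -4 alpha (c^2 - alpha d^2) is the norm of
     2 sqrt alpha (c + d sqrt alpha). *)
  exists (2 * alpha * d), (2 * c).
  rewrite mul1r in E.
  have -> : q ^+ 2 - 4 * alpha * beta = - (4 * alpha) * C_param alpha beta q.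
    by rewrite /C_param; field; rewrite alpha_neq0 four0.
  by rewrite E; ring.
exists (d / 2), (c / (2 * alpha)).
have -> : C_param alpha beta q = - (c ^+ 2 - alpha * d ^+ 2) / (4 * alpha).
  by rewrite E /C_param opprB.
by field; rewrite alpha_neq0 four0 two_neq0.
Qed.
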